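(* Let $E$ be a sequentially complete locally convex topological vector space. For each $i\in\{0,1\}$ let $A_i$ be a densely defined linear operator in $E$ such that for some $\lambda_0\in\mathbb{R}$ the resolvent $R_i(\lambda_0)=(\lambda_0\mathbf{1}-A_i)^{-1}$ is defined on the whole of $E$, and the family $\{(\lambda R_i(\lambda))^m:\lambda\geq 1,\ m\in\mathbb{N}\}$, where $R_i(\lambda)=(\lambda\mathbf{1}-A_i)^{-1}$, is equicontinuous. Let $\Omega_i=(\Omega_i(t))_{t\ge 0}$ be the one-parameter operator semigroup on $E$ generated by $A_i$. Suppose that the operator $D=A_1-A_0$ is defined and continuous on the whole of $E$. Then for every $t\geq 0$ $$\Omega_1(t)=\Omega_0(t)+\int_0^t\Omega_0(t-\tau)\,D\,\Omega_1(\tau)\,d\tau$$ and $$\Omega_1(t)=\Omega_0(t)+\int_0^t\Omega_1(t-\tau)\,D\,\Omega_0(\tau)\,d\tau .$$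
   Context: Topological vector spaces are taken to be Hausdorff. $\mathbf{1}$ denotes the identity operator on $E$. A family $\{f_\theta:\theta\in\Theta\}$ of maps from $E$ to $E$ is equicontinuous if for every continuous seminorm $\|\cdot\|$ on $E$ there is a continuous seminorm $\|\cdot\|'$ on $E$ such that $\|f_\theta(q)\|\le\|q\|'$ for all $\theta\in\Theta$ and $q\in E$. The assumption on the family $\{(\lambda R_i(\lambda))^m\}$ includes that $R_i(\lambda)$ exists as an operator defined on all of $E$ for each $\lambda\ge 1$. Under these assumptions $A_i$ generates, by the Hille--Yosida theorem, a unique strongly continuous equicontinuous semigroup $\Omega_i$ of continuous linear operators on $E$: $\Omega_i(0)=\mathbf{1}$, $\Omega_i(s+t)=\Omega_i(s)\Omega_i(t)$, $t\mapsto\Omega_i(t)q$ is continuous for each $q\in E$, and $A_i q=\lim_{h\downarrow 0}h^{-1}(\Omega_i(h)q-q)$ with domain exactly the set of $q$ for which the limit exists. That $D=A_1-A_0$ is defined on the whole of $E$ and continuous means: $A_0$ and $A_1$ have the same domain $S$, and there is a continuous linear operator $D:E\to E$ with $A_1q=A_0q+Dq$ for all $q\in S$. The integrals are understood in the strong sense: applied to each $q\in E$, they are Riemann integrals of continuous $E$-valued functions on $[0,t]$. *)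

(* Defs.v *)
From HB Require Import structures.
From mathcomp Require Import all_boot all_order all_algebra.
From mathcomp Require Import all_classical all_reals all_analysis.
From mathcomp Require Import complex.

Set Implicit Arguments.
Unset Strict Implicit.
Unset Printing Implicit Defensive.

Import Order.TTheory GRing.Theory Num.Theory.
Import numFieldNormedType.Exports.

Local Open Scope classical_set_scope.
Local Open Scope ring_scope.

(* The scalar field [K] is the real or the complex field. Both are handled at
   once through an embedding [iota] of the reals that is compatible with
   absolute values and such that all absolute values in [K] are real. The two
   lemmas below are the intended instances (by Gelfand-Mazur, the only ones). *)
Definition real_or_complex (R : realType) (K : numFieldType)
    (iota : {rmorphism R -> K}) :=
  (forall r : R, `|iota r| = iota `|r|) /\
  (forall z : K, exists r : R, `|z| = iota r).

Lemma real_or_complex_real (R : realType) :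
  real_or_complex (idfun : {rmorphism R -> R}).
Proof. by split=> // z; exists `|z|. Qed.

Lemma real_or_complex_complex (R : realType) :
  real_or_complex (real_complex R : {rmorphism R -> R[i]}).
Proof.
split=> [r|z]; last by eexists; rewrite normc_def.
by rewrite normc_def /= expr0n /= addr0 sqrtr_sqr.
Qed.

(* A linear operator in [E] is a subspace [dom] with a function that is linear
   on [dom]; its values outside [dom] are irrelevant. *)
Record linear_operator (K : numFieldType) (E : lmodType K) := LinearOperator {
  dom : set E ;
  op_fun :> E -> E ;
  dom0 : dom 0 ;
  dom_linear : forall (a : K) (x y : E), dom x -> dom y -> dom (a *: x + y) ;
  op_linear : forall (a : K) (x y : E), dom x -> dom y ->
    op_fun (a *: x + y) = a *: op_fun x + op_fun y }.

(* Cauchy sequences are those of the vector topology: the uniform structure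
   carried by a [tvsType] is only required to induce the topology, so the
   library's entourage-based notion of Cauchy filter need not be the right
   one. *)
Definition sequentially_complete (K : numFieldType) (E : tvsType K) :=
  forall u : nat -> E,
    (forall U : set E, nbhs 0 U ->
      exists N : nat, forall m n : nat, (N <= m)%N -> (N <= n)%N ->
        U (u m - u n)) ->
    exists l : E, u @ \oo --> l.

Section Semigroups.
Context (R : realType) (K : numFieldType) (iota : {rmorphism R -> K}).
Context (E : tvsType K).

Definition continuous_seminorm (p : E -> R) :=
  [/\ forall x, 0 <= p x,
      forall x y, p (x + y) <= p x + p y,
      forall (z : K) x, iota (p (z *: x)) = `|z| * iota (p x)
    & continuous p].

Definition equicontinuous_family (T : Type) (P : set T) (f : T -> E -> E) :=
  forall p : E -> R, continuous_seminorm p ->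
  exists2 p' : E -> R, continuous_seminorm p' &
    forall (i : T) (q : E), P i -> p (f i q) <= p' q.

Definition is_resolvent (A : linear_operator E) (l : R) (Rl : E -> E) :=
  (forall q, dom A (Rl q) /\ iota l *: Rl q - A (Rl q) = q) /\
  (forall q, dom A q -> Rl (iota l *: q - A q) = q).

Definition equicontinuous_resolvent_powers (A : linear_operator E) :=
  exists Res : R -> E -> E,
    (forall l, 1 <= l -> is_resolvent A l (Res l)) /\
    equicontinuous_family [set lm : R * nat | 1 <= lm.1]
      (fun lm => iter lm.2 (fun q => iota lm.1 *: Res lm.1 q)).

(* Only the values [Omega t] with [0 <= t] are relevant. *)
Definition equicontinuous_semigroup (Omega : R -> E -> E) :=
  [/\ forall t, 0 <= t -> linear (Omega t) /\ continuous (Omega t),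
      Omega 0 = id,
      forall s t, 0 <= s -> 0 <= t -> Omega (s + t) = Omega s \o Omega t,
      forall q, {within `[0, +oo[, continuous (fun t => Omega t q)}
    & equicontinuous_family [set t | 0 <= t] Omega].

Definition is_generator (A : linear_operator E) (Omega : R -> E -> E) :=
  let quotient q h := iota h^-1 *: (Omega h q - q) in
  (forall q, dom A q <-> exists l : E, quotient q h @[h --> 0^'+] --> l) /\
  (forall q, dom A q -> quotient q h @[h --> 0^'+] --> A q).

Definition generated_semigroup (A : linear_operator E) (Omega : R -> E -> E) :=
  equicontinuous_semigroup Omega /\ is_generator A Omega.

Definition riemann_sum (f : R -> E) (a b : R) (s : seq R) (c : nat -> R) : E :=
  \sum_(i < size s) iota (s`_i - (a :: s)`_i) *: f (c i).

(* [s] lists the division points other than [a], and [c i] is the tag of the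
   [i]-th subinterval. *)
Definition is_riemann_integral (f : R -> E) (a b : R) (I : E) :=
  forall U : set E, nbhs I U ->
  exists2 d : R, 0 < d &
    forall (s : seq R) (c : nat -> R), itv_partition a b s ->
      (forall i, (i < size s)%N ->
        s`_i - (a :: s)`_i < d /\ (a :: s)`_i <= c i <= s`_i) ->
      U (riemann_sum f a b s c).

Definition is_strong_integral (F : R -> E -> E) (a b : R) (J : E -> E) :=
  forall q, {within `[a, b], continuous (fun tau => F tau q)} /\
    is_riemann_integral (fun tau => F tau q) a b (J q).

End Semigroups.

(* Main.v *)
Require Import Defs.
From HB Require Import structures.
From mathcomp Require Import all_boot all_order all_algebra.
From mathcomp Require Import all_classical all_reals all_analysis.
From mathcomp Require Import ring lra.

(** For [q] in the common domain of the generators, the interpolation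
    [F tau = Omega0 (t - tau) (Omega1 tau q)] runs from [Omega0 t q] at
    [tau = 0] to [Omega1 t q] at [tau = t]. Its right derivative is
    [Omega0 (t - tau) (A1 - A0) (Omega1 tau q) = Omega0 (t - tau) (D (Omega1 tau q))],
    because [Omega1 tau] preserves the domain and equicontinuity makes
    [(s, x) |-> Omega0 s x] jointly continuous
    ([interpolation_right_derivative]). Integrating this derivative gives the
    first formula on the domain. The Riemann sums of the integrand, as maps of
    [q], and the map [q |-> Omega1 t q - Omega0 t q] are equicontinuous, so the
    formula passes to the closure of the domain, which is [E]
    ([riemann_integral_dense], [duhamel]). Exchanging the two semigroups and
    replacing [D] by [- D] gives the second formula.

    Convergence of the Riemann sums is obtained together with the value of the
    integral: if [F] has a continuous right derivative [f] on [[a, b]], a mean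
    value inequality on each piece of the partition compares the Riemann sum of
    [f] with [F b - F a] ([right_derivative_riemann_integral]).

    All estimates are made with continuous seminorms. They determine the
    topology ([cvg_seminormP]): every neighbourhood of the origin contains an
    absolutely convex one, whose Minkowski gauge is a continuous seminorm. *)

Set Implicit Arguments.
Unset Strict Implicit.

Import Order.TTheory GRing.Theory Num.Theory.
Import numFieldNormedType.Exports.

Local Open Scope classical_set_scope.
Local Open Scope ring_scope.

(** * The scalar embedding *)

Section Scalars.
Context {R : realType} {K : numFieldType} {iota : {rmorphism R -> K}}.
Hypothesis HK : real_or_complex iota.

Lemma norm_iota (r : R) : `|iota r| = iota `|r|.
Proof. by case: HK. Qed.

Let iota_inj : injective iota := fmorph_inj iota.

Lemma iota_le (x y : R) : (iota x <= iota y) = (x <= y).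
Proof.
have ge0 r : (0 <= iota r) = (0 <= r).
  apply/idP/idP => [/ger0_norm|/ger0_norm r0]; last first.
    by rewrite -r0 -norm_iota normr_ge0.
  by rewrite norm_iota => /iota_inj <-; exact: normr_ge0.
by rewrite -subr_ge0 -rmorphB ge0 subr_ge0.
Qed.

Lemma iota_lt (x y : R) : (iota x < iota y) = (x < y).
Proof. by rewrite !lt_neqAle iota_le (inj_eq iota_inj). Qed.

Lemma norm_real (z : K) : exists2 c : R, 0 <= c & `|z| = iota c.
Proof.
case: HK => _ /(_ z)[c zc]; exists c => //.
by rewrite -iota_le rmorph0 -zc.
Qed.

End Scalars.

(** * Continuous seminorms of a locally convex space *)

Section Gauge.
Context {R : realType} {K : numFieldType} {iota : {rmorphism R -> K}}.
Hypothesis HK : real_or_complex iota.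
Context {E : tvsType K}.
Implicit Types (U W : set E) (x y : E) (r s : R).

Definition absolutely_convex W :=
  (forall (z : K) x, `|z| <= 1 -> W x -> W (z *: x)) /\
  (forall r x y, 0 <= r <= 1 -> W x -> W y ->
     W (iota r *: x + iota (1 - r) *: y)).

(** The balanced core of a convex neighbourhood is still convex, and it is a
    neighbourhood because scaling is jointly continuous at [(0, 0)]. *)
Lemma nbhs0_absolutely_convex U : nbhs (0 : E) U ->
  exists W, [/\ nbhs (0 : E) W, W `<=` U & absolutely_convex W].
Proof.
move=> U0; have [B Bconvex [Bopen /(_ 0 U U0)[b [Bb b0] bU]]] := @locally_convex K E.
have nb : nbhs (0 : E) b by apply: open_nbhs_nbhs; split=> //; exact: Bopen.
have Kconv r x y : 0 <= r <= 1 -> b x -> b y ->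
    b (iota r *: x + iota (1 - r) *: y).
  move=> /andP[r0 r1] bx by_.
  have i0 : 0 <= iota r by rewrite -(rmorph0 iota) (iota_le HK).
  have i1 : iota r <= 1 by rewrite -(rmorph1 iota) (iota_le HK).
  have := Bconvex b _ x y (Itv01 i0 i1); rewrite !inE => /(_ Bb bx by_).
  by rewrite rmorphB rmorph1.
have [[V1 V2]/= [V10 V20] Vb] : nbhs ((0 : K^o), (0 : E)) [set z | b (z.1 *: z.2)].
  by apply: scale_continuous; rewrite /= scale0r.
have [e /= e0 eV1] : nbhs_ball (0 : K^o) V1 by rewrite nbhs_ballE.
pose w : K := e / 2.
have w0 : 0 < w by rewrite divr_gt0.
exists [set x | forall z : K, `|z| <= 1 -> b (z *: x)]; split.
- apply: filterS (nbhs0Z (lt0r_neq0 w0) V20) => x [v V2v <-] z z1.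
  rewrite scalerA; apply: (Vb (z * w, v)); split=> //=; apply: eV1.
  rewrite /ball /= sub0r normrN normrM (gtr0_norm w0).
  by rewrite (le_lt_trans (ler_piMl (ltW w0) z1))// gtr_pMr// invf_lt1// ltr1n.
- by move=> x /(_ 1); rewrite normr1 scale1r => /(_ (lexx _))/bU.
- split=> [z x z1 bx z' z'1|r x y r01 bx bY z z1].
    by rewrite scalerA; apply: bx; rewrite normrM mulr_ile1.
  rewrite scalerDr !scalerA ![z * _]mulrC -!scalerA.
  by apply: Kconv => //; [exact: bx|exact: bY].
Qed.

Definition gauge W x : R := inf [set r | 0 < r /\ W (iota r^-1 *: x)].

Section GaugeTheory.
Variable W : set E.
Hypotheses (W0 : nbhs (0 : E) W) (Wac : absolutely_convex W).

Let scales x : set R := [set r | 0 < r /\ W (iota r^-1 *: x)].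

Let scales_up x r s : scales x r -> r <= s -> scales x s.
Proof.
move=> [r0 Wr] rs; have s0 := lt_le_trans r0 rs; split=> //.
have -> : iota s^-1 *: x = iota (s^-1 * r) *: (iota r^-1 *: x).
  by rewrite scalerA -rmorphM mulfK// gt_eqF.
apply: Wac.1 => //; rewrite (norm_iota HK) -(rmorph1 iota) (iota_le HK) ger0_norm.
  by rewrite ler_pdivrMl// mulr1.
by rewrite mulr_ge0// ?invr_ge0 ltW.
Qed.

(** Scaling of the fixed vector [x] is continuous at the scalar [0]. *)
Let scales_nonempty x : scales x !=set0.
Proof.
have [[V1 V2]/= [V10 V20] VW] : nbhs ((0 : K^o), x) [set z | W (z.1 *: z.2)].
  by apply: scale_continuous; rewrite /= scale0r.
have [e /= e0 eV1] : nbhs_ball (0 : K^o) V1 by rewrite nbhs_ballE.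
have [c c0 ec] := norm_real HK e.
have {}ec : e = iota c by rewrite -ec gtr0_norm.
have {}c0 : 0 < c by rewrite -(iota_lt HK) rmorph0 -ec.
exists (c / 2)^-1; split; first by rewrite invr_gt0 divr_gt0.
rewrite invrK; apply: (VW (iota (c / 2), x)); split; last exact: nbhs_singleton.
apply: eV1; rewrite /ball /= sub0r normrN (norm_iota HK) ec (iota_lt HK).
by rewrite gtr0_norm ?divr_gt0// gtr_pMr// invf_lt1// ltr1n.
Qed.

Let scales_lb x : has_lbound (scales x).
Proof. by exists 0 => r [/ltW]. Qed.

Let gauge_ge0 x : 0 <= gauge W x.
Proof. by apply: lb_le_inf; [exact: scales_nonempty|move=> r [/ltW]]. Qed.

Lemma gauge_lt x r : gauge W x < r -> W (iota r^-1 *: x).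
Proof.
move=> /(inf_lt (scales_nonempty x))[s xs /ltW sr].
exact: (scales_up xs sr).2.
Qed.

Lemma gauge_le x r : 0 < r -> W (iota r^-1 *: x) -> gauge W x <= r.
Proof. by move=> r0 Wr; apply: ge_inf => //; exact: scales_lb. Qed.

Let gaugeD x y : gauge W (x + y) <= gauge W x + gauge W y.
Proof.
apply/ler_addgt0Pl => e e0.
pose r := gauge W x + e / 2; pose s := gauge W y + e / 2.
have e20 : 0 < e / 2 by rewrite divr_gt0.
have r0 : 0 < r by rewrite ltr_wpDl.
have s0 : 0 < s by rewrite ltr_wpDl.
have -> : e + (gauge W x + gauge W y) = r + s.
  by rewrite /r /s addrACA -splitr addrC.
apply: gauge_le; first exact: addr_gt0.
have rs0 : r + s != 0 by rewrite gt_eqF// addr_gt0.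
(* [(x + y) / (r + s)] is a convex combination of [x / r] and [y / s]. *)
have -> : iota (r + s)^-1 *: (x + y) =
    iota (r / (r + s)) *: (iota r^-1 *: x) +
    iota (1 - r / (r + s)) *: (iota s^-1 *: y).
  rewrite !scalerA -!rmorphM scalerDr; congr (iota _ *: _ + iota _ *: _).
    by field; rewrite rs0 gt_eqF.
  by field; rewrite rs0 gt_eqF.
apply: Wac.2; last 2 first.
- by apply: gauge_lt; rewrite ltrDl.
- by apply: gauge_lt; rewrite ltrDl.
have rs_gt0 := addr_gt0 r0 s0.
by rewrite (divr_ge0 (ltW r0) (ltW rs_gt0))/= ler_pdivrMr// mul1r lerDl ltW.
Qed.

Let gaugeZ_le (z : K) (c : R) x : 0 <= c -> `|z| = iota c ->
  gauge W (z *: x) <= c * gauge W x.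
Proof.
move=> c0 zc; apply/ler_addgt0Pl => e e0.
have c10 : 0 < c + 1 by rewrite ltr_wpDl.
(* The denominator is [c + 1] and not [c] because [c] may vanish. *)
pose r := gauge W x + e / (c + 1).
have r0 : 0 < r by rewrite ltr_wpDl// divr_gt0.
have le_s : c * r <= e + c * gauge W x.
  rewrite mulrDr addrC lerD2r mulrA ler_pdivrMr// mulrC ler_pM2l//.
  by rewrite lerDl.
have s0 : 0 < e + c * gauge W x by rewrite ltr_pwDl// mulr_ge0.
apply: gauge_le => //.
set s := e + _ in le_s s0 *.
have -> : iota s^-1 *: (z *: x) = (iota (s^-1 * r) * z) *: (iota r^-1 *: x).
  by rewrite !scalerA mulrAC -rmorphM mulfK ?gt_eqF.
apply: Wac.1; last by apply: gauge_lt; rewrite ltrDl divr_gt0.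
rewrite normrM (norm_iota HK) zc -rmorphM -(rmorph1 iota) (iota_le HK).
rewrite ger0_norm ?mulr_ge0 ?invr_ge0 ?(ltW s0) ?(ltW r0)//.
by rewrite -mulrA ler_pdivrMl// mulr1 mulrC.
Qed.

(** Applying the upper bound to [z^-1] gives the lower bound. *)
Let gaugeZ (z : K) x : iota (gauge W (z *: x)) = `|z| * iota (gauge W x).
Proof.
have [c c0 zc] := norm_real HK z.
rewrite zc -rmorphM; congr (iota _); apply/eqP; rewrite eq_le gaugeZ_le//=.
have [z0|z0] := eqVneq z 0.
  suff -> : c = 0 by rewrite mul0r gauge_ge0.
  by apply: (fmorph_inj iota); rewrite -zc z0 normr0 rmorph0.
have c0' : 0 < c by rewrite -(iota_lt HK) rmorph0 -zc normr_gt0.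
rewrite -ler_pdivlMl// -{1}(scalerK z0 x); apply: gaugeZ_le.
  by rewrite invr_ge0.
by rewrite normfV zc fmorphV.
Qed.

Let gauge_near0 e : 0 < e -> \forall x \near (0 : E), gauge W x <= e.
Proof.
move=> e0; have ie0 : iota e != 0 by rewrite fmorph_eq0 gt_eqF.
apply: filterS (nbhs0Z ie0 W0) => x [v Wv <-]; apply: gauge_le => //.
by rewrite scalerA -rmorphM mulVf ?gt_eqF// rmorph1 scale1r.
Qed.

Lemma gauge_continuous_seminorm : continuous_seminorm iota (gauge W).
Proof.
split=> // x; apply/cvgrPdist_le => /= e e0.
have nx := nbhsT x (gauge_near0 e0).
apply: filterS nx => _ [v ve <-].
have gN u : gauge W (- u) = gauge W u.
  by apply: (fmorph_inj iota); rewrite -scaleN1r gaugeZ normrN1 mul1r.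
rewrite ler_distlC; apply/andP; split.
  rewrite lerBlDr -[in leLHS](addrK v x) (le_trans (gaugeD _ _))// gN lerD2l.
  exact: ve.
by rewrite (le_trans (gaugeD _ _))// lerD2l; exact: ve.
Qed.

End GaugeTheory.
End Gauge.

Section SeminormTopology.
Context {R : realType} {K : numFieldType} {iota : {rmorphism R -> K}}.
Hypothesis HK : real_or_complex iota.
Context {E : tvsType K}.
Implicit Types (U : set E) (p : E -> R) (x y : E).

Local Notation seminorm := (@continuous_seminorm R K iota E).

Lemma seminorm_ge0 p x : seminorm p -> 0 <= p x.
Proof. by case. Qed.

Lemma seminormD p x y : seminorm p -> p (x + y) <= p x + p y.
Proof. by case. Qed.

Lemma seminormZ p r x : seminorm p -> p (iota r *: x) = `|r| * p x.
Proof.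
case=> _ _ pZ _; apply: (fmorph_inj iota); rewrite pZ rmorphM.
by case: HK => -> _.
Qed.

Lemma seminorm0 p : seminorm p -> p 0 = 0.
Proof.
by move=> sp; have := seminormZ 0 0 sp; rewrite scaler0 normr0 mul0r.
Qed.

Lemma seminormN p x : seminorm p -> p (- x) = p x.
Proof.
by move=> sp; have := seminormZ (-1) x sp; rewrite rmorphN1 scaleN1r normrN1 mul1r.
Qed.

Lemma seminormBC p x y : seminorm p -> p (x - y) = p (y - x).
Proof. by move=> sp; rewrite -(seminormN (x - y) sp) opprB. Qed.

Lemma seminorm_triangle p x y z : seminorm p -> p (x - z) <= p (x - y) + p (y - z).
Proof.
by move=> sp; rewrite (_ : x - z = (x - y) + (y - z)) ?seminormD// addrA subrK.
Qed.

Lemma seminorm_near p e l : seminorm p -> 0 < e ->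
  \forall x \near l, p (x - l) < e.
Proof.
move=> sp e0; have [_ _ _ /(_ 0)/cvgrPdist_lt/(_ _ e0)] := sp.
move=> /(nbhsT l); apply: filterS => _ [v + <-].
by rewrite (seminorm0 sp) sub0r normrN ger0_norm ?seminorm_ge0// addrAC subrr add0r.
Qed.

(** [p] is the gauge of an absolutely convex neighbourhood of the origin inside
    [U - l]. *)
Lemma nbhs_seminorm l U : nbhs l U ->
  exists2 p, seminorm p & forall x, p (x - l) < 1 -> U x.
Proof.
move=> Ul; have Ul0 : nbhs (0 : E) [set x | U (x + l)].
  have := nbhsB (- l) Ul; rewrite addNr; apply: filterS => _ [u Uu <-] /=.
  by rewrite addrC addNKr.
have [W [W0 WU Wac]] := nbhs0_absolutely_convex HK Ul0.
exists (gauge (iota := iota) W); first exact: gauge_continuous_seminorm.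
move=> x /(gauge_lt HK W0 Wac); rewrite invr1 rmorph1 scale1r => /WU /=.
by rewrite subrK.
Qed.

Lemma cvg_seminormP {T : Type} {F : set_system T} {FF : Filter F} (f : T -> E) l :
  f @ F --> l <->
  forall p, seminorm p -> forall e, 0 < e -> \forall i \near F, p (f i - l) < e.
Proof.
split=> [fl p sp e e0|H U /nbhs_seminorm[p sp pU]].
  exact: (fl _ (seminorm_near l sp e0)).
by apply: filterS (H p sp _ ltr01) => i; exact: pU.
Qed.
End SeminormTopology.

(** * A fundamental theorem of calculus with right derivatives *)

Section RightDerivative.
Context {R : realType}.

(** The points where [g] does not exceed [g a] form a closed set; its supremum
    can only be [b], because the local hypothesis moves any smaller point to
    the right inside the set. *)
Lemma right_nonincreasing_le (g : R -> R) (a b : R) : a <= b ->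
  {within `[a, b], continuous g} ->
  (forall x, a <= x < b -> \forall h \near 0^'+, g (x + h) <= g x) ->
  g b <= g a.
Proof.
move=> ab /subspace_continuousP gcont gdec.
pose S := [set x | a <= x <= b /\ g x <= g a].
have Sa : S a by rewrite /S /= lexx ab.
have S0 : S !=set0 by exists a.
have Sb : ubound S b by move=> x [/andP[]].
have supS : has_sup S by split=> //; exists b.
pose c := sup S.
have ac : a <= c by apply: ub_le_sup => //; exists b.
have cb : c <= b by apply: ge_sup.
have gc : g c <= g a.
  rewrite leNgt; apply/negP => gac.
  have /gcont/cvgrPdist_lt/(_ (g c - g a)) : `[a, b]%classic c.
    by rewrite /= in_itv/= ac cb.
  rewrite subr_gt0 => /(_ gac); rewrite near_withinE near_simpl => -[d /= d0 Hd].
  have [x [xab gx] xc] := sup_adherent d0 supS.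
  have xc' : x <= c by apply: ub_le_sup => //; exists b.
  have := Hd x; rewrite /= in_itv/= xab ger0_norm ?subr_ge0// ltrBlDl -ltrBlDr.
  move=> /(_ xc isT)/ltr_normlW; rewrite ltrD2l ltrN2 => gax.
  by move: gax; rewrite ltNge gx.
have : ~ c < b.
  move=> cltb; have [] := @filter_ex _ (0 : R)^'+ _
    (fun h => [/\ 0 < h, h < b - c & g (c + h) <= g c]).
    near=> h; split; near: h; first exact: nbhs_right_gt.
      by apply: nbhs_right_lt; rewrite subr_gt0.
    by apply: gdec; rewrite ac.
  move=> h [h0 hb gh].
  have : c + h <= c.
    apply: ub_le_sup; first by exists b.
    split; last exact: le_trans gc.
    by apply/andP; split; lra.
  lra.
move=> /negP; rewrite -leNgt => bc.
by have -> : b = c by apply: le_anti; rewrite bc cb.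
Unshelve. all: by end_near. Qed.

End RightDerivative.

Section Calculus.
Context {R : realType} {K : numFieldType} {iota : {rmorphism R -> K}}.
Hypothesis HK : real_or_complex iota.
Context {E : tvsType K}.
Implicit Types (f F : R -> E) (p : E -> R) (a b : R).

Local Notation seminorm := (@continuous_seminorm R K iota E).

(** With [u x = F x - iota x *: v], the quantity [p (u x - u a)] increases by at
    most [e * h] on a short step [h] to the right of [x], so that
    [p (u x - u a) - e * (x - a)] does not increase to the right. *)
Lemma mean_value_right p F (v : E) (a b e : R) : seminorm p -> a <= b ->
  {within `[a, b], continuous F} ->
  (forall x, a <= x < b ->
    \forall h \near 0^'+, p (F (x + h) - F x - iota h *: v) <= e * h) ->
  p (F b - F a - iota (b - a) *: v) <= e * (b - a).
Proof.
move=> sp ab /subspace_continuousP Fcont Fder.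
pose u x := F x - iota x *: v.
pose G x := u x - u a.
pose g x := p (G x) - e * (x - a).
have GB x y : G y - G x = F y - F x - iota (y - x) *: v.
  have BB (w1 w2 w : E) : (w1 - w) - (w2 - w) = w1 - w2.
    by rewrite opprB addrA subrK.
  by rewrite /G BB /u rmorphB scalerBl !opprD addrACA.
have Ga : G a = 0 by rewrite /G subrr.
suff : g b <= g a.
  by rewrite /g Ga subrr (seminorm0 HK sp) mulr0 subr0 subr_le0 -GB Ga subr0.
apply: right_nonincreasing_le => //.
  apply/subspace_continuousP => x xab; apply: cvgB; last first.
    apply: cvg_within_filter; apply: cvgMl_tmp.
    by apply: cvgB; [exact: cvg_id|exact: cvg_cst].
  have [_ _ _ pcont] := sp.
  apply: (@cvg_comp _ _ _ G p _ (nbhs (G x))); last exact: pcont.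
  apply/(cvg_seminormP HK) => q sq r r0.
  have r20 : 0 < r / 2 by rewrite divr_gt0.
  have d0 : 0 < r / 2 / (q v + 1).
    by rewrite divr_gt0// ltr_wpDl// (seminorm_ge0 _ sq).
  have Fx := (cvg_seminormP HK _ _).1 (Fcont x xab) q sq _ r20.
  near=> y; rewrite GB.
  have h1 : q (F y - F x) < r / 2 by near: y; exact: Fx.
  have h2 : `|y - x| < r / 2 / (q v + 1).
    rewrite distrC; near: y; exact: (cvg_within _ (nbhsx_ballx x _ d0)).
  have := seminormD (F y - F x) (- (iota (y - x) *: v)) sq.
  rewrite (seminormN HK)// (seminormZ HK)// => /le_lt_trans; apply.
  rewrite [ltRHS](splitr r) ltr_leD//.
  move: h2; rewrite ltr_pdivlMr ?ltr_wpDl ?(seminorm_ge0 _ sq)// => /ltW.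
  by apply: le_trans; rewrite ler_wpM2l// lerDl.
move=> x /andP[ax xb]; have := Fder x; rewrite ax xb => /(_ isT).
apply: filterS => h; rewrite /g => Fh.
have := seminormD (G x) (G (x + h) - G x) sp; rewrite addrC subrK GB.
rewrite (_ : x + h - x = h); last by rewrite addrAC subrr add0r.
move: Fh; lra.
Unshelve. all: by end_near. Qed.

(** The Heine-Cantor theorem for one seminorm at a time. *)
Lemma seminorm_uniform_continuous p f (a b e : R) : seminorm p -> 0 < e ->
  {within `[a, b], continuous f} ->
  exists2 d, 0 < d & forall x y, a <= x <= b -> a <= y <= b -> `|x - y| < d ->
    p (f x - f y) < e.
Proof.
move=> sp e0 /subspace_continuousP fcont.
have e20 : 0 < e / 2 by rewrite divr_gt0.
pose P (d x : R) :=
  forall y, a <= y <= b -> `|x - y| < d -> p (f x - f y) < e.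
have : \forall d \near (0 : R)^'+, `[a, b]%classic `<=` P d.
  move: (@segment_compact R a b) => /compact_near_coveringP/near_covering_withinP.
  apply=> x xab.
  have /(cvg_seminormP HK)/(_ p sp _ e20) := fcont x xab.
  rewrite near_withinE near_simpl => -[r /= r0 Hr].
  have near_x y : a <= y <= b -> `|x - y| < r -> p (f y - f x) < e / 2.
    by move=> yab xy; apply: Hr => //; rewrite /= in_itv.
  near=> x' d => /=; rewrite in_itv/= => x'ab y yab x'y.
  have x'x : `|x - x'| < r / 2.
    by near: x'; apply: (nbhsx_ballx x (r / 2)); rewrite divr_gt0.
  have dr : d < r / 2 by near: d; apply: nbhs_right_lt; rewrite divr_gt0.
  rewrite (le_lt_trans (seminorm_triangle _ (f x) _ sp))// [ltRHS]splitr ltrD//.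
    by apply: near_x => //; lra.
  rewrite (seminormBC HK)//; apply: near_x => //.
  rewrite (le_lt_trans (ler_distD x' _ _))//; lra.
move=> H; have [d [d0 Hd]] := @filter_ex _ (0 : R)^'+ _ _
  (filterI (nbhs_right_gt 0) H).
by exists d => // x y xab; apply: Hd; rewrite /= in_itv.
Unshelve. all: by end_near. Qed.

(** Errors on the pieces of a partition add up. With [F = 0] the same
    statement bounds Riemann sums. *)
Lemma riemann_sum_error p F f a b s (c : nat -> R) (M : R) : seminorm p ->
  (forall i, (i < size s)%N ->
    p (F s`_i - F (a :: s)`_i - iota (s`_i - (a :: s)`_i) *: f (c i))
      <= M * (s`_i - (a :: s)`_i)) ->
  p (F (last a s) - F a - riemann_sum iota f a b s c) <= M * (last a s - a).
Proof.
move=> sp; elim: s a c => [|x s IH] a c Hi.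
  by rewrite /riemann_sum big_ord0 /= !subrr (seminorm0 HK)// mulr0.
have IHs := IH x (c \o S) (fun i => Hi i.+1).
have /= H0 := Hi 0%N isT.
have -> : F (last a (x :: s)) - F a - riemann_sum iota f a b (x :: s) c =
   (F x - F a - iota (x - a) *: f (c 0%N)) +
   (F (last x s) - F x - riemann_sum iota f x b s (c \o S)).
  rewrite /riemann_sum big_ord_recl /=.
  set u := iota _ *: _; set w := \sum_(i < _) _.
  by rewrite [RHS]addrACA -opprD [F x - F a + _]addrC addrA subrK.
rewrite (le_trans (seminormD _ _ sp))//=; move: H0 IHs => /=; lra.
Qed.

Lemma itv_partition_nth a b s i : itv_partition a b s -> (i < size s)%N ->
  a <= (a :: s)`_i /\ s`_i <= b.
Proof.
move=> sab si; split.
  by rewrite (set_nth_default b) ?ltnS ?(ltnW si)// itv_partition_nth_ge// ltnS ltnW.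
by have := itv_partition_nth_le (m := i.+1) si sab; rewrite /= (set_nth_default 0).
Qed.

(** On a partition finer than the modulus of uniform continuity, [f] differs
    from its tagged value by less than [e / 2] on each piece, and the difference
    quotients of [F] on short steps to the right of a point differ from the
    value of [f] there by less than [e / 2]; the mean value inequality with
    slope the tagged value then bounds the error on each piece by [e] times its
    length. *)
Lemma right_derivative_riemann_integral f F a b : a <= b ->
  {within `[a, b], continuous f} -> {within `[a, b], continuous F} ->
  (forall x, a <= x < b ->
    iota h^-1 *: (F (x + h) - F x) @[h --> 0^'+] --> f x) ->
  is_riemann_integral iota f a b (F b - F a).
Proof.
move=> ab fcont Fcont Fder U /(nbhs_seminorm HK)[p sp pU].
have ba0 : 0 < b - a + 1 by rewrite ltr_wpDl// subr_ge0.
(* Chosen so that [e * (b - a) < 1], also when [a = b]. *)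
pose e := (b - a + 1)^-1.
have e0 : 0 < e by rewrite invr_gt0.
have e20 : 0 < e / 2 by rewrite divr_gt0.
have [d d0 Hd] := seminorm_uniform_continuous sp e20 fcont.
exists d => // s c sab Hs; apply: pU; rewrite (seminormBC HK)//.
have slast : last a s = b by case: sab => _ /eqP.
have : p (F (last a s) - F a - riemann_sum iota f a b s c) <= e * (last a s - a).
  apply: (@riemann_sum_error p F f a b s c e sp) => i si.
  have [ai bi] := itv_partition_nth sab si.
  have [sd /andP[ci1 ci2]] := Hs i si.
  set x := (a :: s)`_i in ai sd ci1 *; set y := s`_i in bi sd ci2 *.
  have xy : x <= y by exact: le_trans ci2.
  apply: (@mean_value_right p F (f (c i)) x y e) => //.
    apply: continuous_subspaceW Fcont => z /=; rewrite !in_itv/= => /andP[].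
    by move=> /(le_trans ai) -> /le_trans ->.
  move=> z /andP[xz zy].
  have zab : a <= z < b by apply/andP; split; lra.
  have := (cvg_seminormP HK _ _).1 (Fder z zab) p sp _ e20.
  move=> Fz; near=> h.
  have h0 : 0 < h by near: h; exact: nbhs_right_gt.
  have Fzh : p (iota h^-1 *: (F (z + h) - F z) - f z) < e / 2 by near: h; exact: Fz.
  have fz : p (f z - f (c i)) < e / 2.
    apply: Hd; [by apply/andP; split; lra|by apply/andP; split; lra|].
    by rewrite ltr_norml; apply/andP; split; lra.
  have -> : F (z + h) - F z - iota h *: f (c i) =
      iota h *: (iota h^-1 *: (F (z + h) - F z) - f (c i)).
    by rewrite scalerBr scalerA -rmorphM mulfV ?gt_eqF// rmorph1 scale1r.
  rewrite (seminormZ HK)// gtr0_norm// mulrC ler_pM2r//.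
  rewrite (le_trans (seminorm_triangle _ (f z) _ sp))//; lra.
rewrite slast => /le_lt_trans; apply.
by rewrite /e mulrC ltr_pdivrMr// mul1r ltrDl.
Unshelve. all: by end_near. Qed.

Lemma riemann_integral_opp f g a b (I : E) :
  (forall x, a <= x <= b -> g x = - f x) ->
  is_riemann_integral iota f a b I -> is_riemann_integral iota g a b (- I).
Proof.
move=> gf fI U /(@opp_continuous E I)/fI[d d0 Hd].
exists d => // s c sab Hs.
suff -> : riemann_sum iota g a b s c = - riemann_sum iota f a b s c by exact: Hd.
rewrite /riemann_sum -sumrN; apply: eq_bigr => i _.
have [ai bi] := itv_partition_nth sab (ltn_ord i).
have [_ /andP[ci1 ci2]] := Hs i (ltn_ord i).
by rewrite gf ?scalerN// (le_trans ai)//= (le_trans ci2).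
Qed.

(** The Riemann sums of [T] over all partitions of [[a, b]] are equicontinuous
    in [q], with the seminorm [p'] of [T] multiplied by [b - a]; so convergence
    on a dense set gives convergence everywhere. *)
Lemma riemann_integral_dense (T : R -> E -> E) (J : E -> E) (S : set E) a b :
  dense S ->
  (forall x, a <= x <= b -> {morph T x : u v / u - v}) ->
  {morph J : u v / u - v} ->
  equicontinuous_family iota [set x | a <= x <= b] T ->
  equicontinuous_family iota [set: unit] (fun=> J) ->
  (forall q, S q -> is_riemann_integral iota (T ^~ q) a b (J q)) ->
  forall q, is_riemann_integral iota (T ^~ q) a b (J q).
Proof.
move=> Sdense Tlin Jlin Teq Jeq SJ q U /(nbhs_seminorm HK)[p sp pU].
have [p1 sp1 Tp1] := Teq p sp; have [p2 sp2 Jp2] := Jeq p sp.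
have t0 : 0 < 3^-1 :> R by rewrite invr_gt0.
have L0 : 0 < `|b - a| + 1 by rewrite ltr_wpDl.
(* The sums at [q] and [q'], the integrals at [q] and [q'], and the sum and the
   integral at [q'] are each less than [1 / 3] apart. The bound on [b - a] has an
   absolute value because [a <= b] is known only once a partition is given. *)
have [q' [q1 q2] Sq'] : exists2 q', p1 (q' - q) < 3^-1 / (`|b - a| + 1) /\
    p2 (q' - q) < 3^-1 & S q'.
  have : nbhs q [set x | p1 (x - q) < 3^-1 / (`|b - a| + 1) /\ p2 (x - q) < 3^-1].
    by apply: filterI; [exact: (seminorm_near HK q sp1 (divr_gt0 t0 L0))
                       |exact: (seminorm_near HK q sp2 t0)].
  rewrite nbhsE => -[V [Vopen Vq] VP].
  have [q' [Vq' Sq']] := Sdense V (ex_intro _ q Vq) Vopen.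
  by exists q' => //; exact: VP.
have [d d0 Hd] := SJ q' Sq' _ (seminorm_near HK (J q') sp t0).
exists d => // s c sab Hs; apply: pU; have /= Hq' := Hd s c sab Hs.
have ab := itv_partition_le sab.
have slast : last a s = b by case: sab => _ /eqP.
have cab i : (i < size s)%N -> a <= c i <= b.
  move=> si; have [ai bi] := itv_partition_nth sab si.
  have [_ /andP[ci1 ci2]] := Hs i si.
  by rewrite (le_trans ai)//= (le_trans ci2).
have sumB : riemann_sum iota (T ^~ q') a b s c - riemann_sum iota (T ^~ q) a b s c =
    riemann_sum iota (T ^~ (q' - q)) a b s c.
  rewrite /riemann_sum -sumrB; apply: eq_bigr => i _.
  by rewrite -scalerBr Tlin// cab.
have sum_le : p (riemann_sum iota (T ^~ (q' - q)) a b s c) <= p1 (q' - q) * (b - a).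
  have := @riemann_sum_error p (fun=> 0) (T ^~ (q' - q)) a b s c (p1 (q' - q)) sp.
  rewrite slast subrr sub0r (seminormN HK)//; apply=> i si.
  have [ai bi] := itv_partition_nth sab si.
  have [_ /andP[ci1 ci2]] := Hs i si.
  rewrite sub0r (seminormN HK)// (seminormZ HK)// ger0_norm; last first.
    by rewrite subr_ge0 (le_trans ci1).
  rewrite mulrC ler_wpM2r//; first by rewrite subr_ge0 (le_trans ci1).
  by apply: Tp1; exact: cab.
have sum_lt : p1 (q' - q) * (b - a) < 3^-1.
  move: q1; rewrite ltr_pdivlMr// ger0_norm ?subr_ge0//; apply: le_lt_trans.
  by rewrite ler_wpM2l ?(seminorm_ge0 _ sp1)// lerDl.
have Jq : p (J q' - J q) < 3^-1 by rewrite -Jlin (le_lt_trans (Jp2 tt _ _)).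
set s' := riemann_sum _ _ _ _ _ _ in Hq' sumB; rewrite -sumB (seminormBC HK)// in sum_le.
rewrite (le_lt_trans (seminorm_triangle _ s' _ sp))//.
have := seminorm_triangle s' (J q') (J q) sp; lra.
Qed.

End Calculus.

(** * Perturbation of equicontinuous semigroups *)

Section Semigroups.
Context {R : realType} {K : numFieldType} {iota : {rmorphism R -> K}}.
Hypothesis HK : real_or_complex iota.
Context {E : tvsType K}.
Implicit Types (A B : linear_operator E) (U V : R -> E -> E) (s t : R) (q : E).

Local Notation seminorm := (@continuous_seminorm R K iota E).

Lemma semigroupB U s : equicontinuous_semigroup iota U -> 0 <= s ->
  {morph U s : x y / x - y}.
Proof.
move=> [Ulin _ _ _ _] s0 x y; have [sl _] := Ulin s s0.
by rewrite -[x - y]addrC -scaleN1r sl scaleN1r addrC.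
Qed.

Lemma semigroupZ U s (z : K) x : equicontinuous_semigroup iota U -> 0 <= s ->
  U s (z *: x) = z *: U s x.
Proof.
move=> sU s0; have [Ulin _ _ _ _] := sU; have [sl _] := Ulin s s0.
have U0 : U s 0 = 0 by rewrite -[X in U s X](subrr x) semigroupB// subrr.
by rewrite -[z *: x]addr0 sl U0 addr0.
Qed.

(** Equicontinuity upgrades strong continuity to joint continuity of
    [(s, x) |-> U s x]. *)
Lemma semigroup_cvg (T : Type) (F : set_system T) (FF : Filter F) U
    (s : T -> R) (x : T -> E) s0 x0 : equicontinuous_semigroup iota U ->
  (\forall i \near F, 0 <= s i) -> 0 <= s0 -> s @ F --> s0 -> x @ F --> x0 ->
  U (s i) (x i) @[i --> F] --> U s0 x0.
Proof.
move=> sU s_ge0 s00 ss0 xx0; have [_ _ _ /(_ x0)Ucont Ueq] := sU.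
apply/(cvg_seminormP HK) => p sp e e0.
have e20 : 0 < e / 2 by rewrite divr_gt0.
have [p' sp' Up'] := Ueq p sp.
have near1 : \forall i \near F, p (U (s i) x0 - U s0 x0) < e / 2.
  move: Ucont => /subspace_continuousP Ucont.
  have /(cvg_seminormP HK)/(_ p sp _ e20) : U t x0 @[t --> within `[0, +oo[ (nbhs s0)]
      --> U s0 x0 by apply: Ucont; rewrite /= in_itv/= s00.
  rewrite near_withinE near_simpl => /ss0 H.
  by apply: filterS2 s_ge0 H => i si; apply; rewrite /= in_itv/= si.
have near2 := (cvg_seminormP HK _ _).1 xx0 p' sp' _ e20.
near=> i.
have si : 0 <= s i by near: i.
rewrite (le_lt_trans (seminorm_triangle _ (U (s i) x0) _ sp))// [ltRHS]splitr.
rewrite ltrD//; last by near: i.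
rewrite -semigroupB// (le_lt_trans (Up' _ _ si))//; near: i; exact: near2.
Unshelve. all: by end_near. Qed.

(** With [C = D] this is the integrand of the theorem, with [C = id] the
    interpolation whose derivative it is. *)
Lemma convolution_continuous U V (C : E -> E) t q :
  equicontinuous_semigroup iota U -> equicontinuous_semigroup iota V ->
  continuous C ->
  {within `[0, t], continuous (fun tau => V (t - tau) (C (U tau q)))}.
Proof.
move=> sU sV Ccont; apply/subspace_continuousP => tau /=.
rewrite in_itv/= => /andP[tau0 taut].
have near_tau : \forall x \near within `[0, t] (nbhs tau), 0 <= x <= t.
  by apply: withinT => x; rewrite /= in_itv.
apply: semigroup_cvg => //.
- by near=> x; rewrite subr_ge0; near: x; apply: filterS near_tau => x /andP[].
- by rewrite subr_ge0.
- by apply: cvgB; [exact: cvg_cst|exact: cvg_within].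
apply: (@cvg_comp _ _ _ _ C _ (nbhs (U tau q))); last exact: Ccont.
apply: semigroup_cvg => //.
- by apply: filterS near_tau => x /andP[].
- exact: cvg_within.
- exact: cvg_cst.
Unshelve. all: by end_near. Qed.

(** The semigroup commutes with its difference quotients, whose limit it
    preserves by continuity. *)
Lemma generator_dom_invariant A U s q : generated_semigroup iota A U ->
  0 <= s -> dom A q -> dom A (U s q).
Proof.
move=> [sU [domA genA]] s0 Aq; apply/domA; exists (U s (A q)).
have [_ _ Uadd _ _] := sU.
have : U s (iota h^-1 *: (U h q - q)) @[h --> 0^'+] --> U s (A q).
  apply: semigroup_cvg => //; [exact: nearW|exact: cvg_cst|exact: genA].
apply: cvg_trans; apply: near_eq_cvg; near=> h.
have h0 : 0 <= h by apply: ltW; near: h; exact: nbhs_right_gt.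
rewrite semigroupZ// semigroupB//; congr (_ *: (_ - _)).
by rewrite -[LHS]/((U s \o U h) q) -[RHS]/((U h \o U s) q) -!Uadd// addrC.
Unshelve. all: by end_near. Qed.

(** As [U h x] and [V h x] have the same value at [h = 0], the difference of
    the two generators is the right derivative of their difference at [0];
    multiplying by [V (t - tau - h)], which converges to [V (t - tau)] on
    convergent arguments, gives the derivative of the interpolation
    [V (t - tau) (U tau q)] between [V t q] and [U t q]. *)
Lemma interpolation_right_derivative A B U V t tau q :
  generated_semigroup iota A U -> generated_semigroup iota B V ->
  dom A = dom B -> dom A q -> 0 <= tau < t ->
  iota h^-1 *: (V (t - (tau + h)) (U (tau + h) q) - V (t - tau) (U tau q))
    @[h --> 0^'+] --> V (t - tau) (A (U tau q) - B (U tau q)).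
Proof.
move=> gU gV AB Aq /andP[tau0 taut].
have Ax := generator_dom_invariant gU tau0 Aq.
have [[sU [_ genA]] [sV [_ genB]]] := (gU, gV).
have [_ _ Uadd _ _] := sU; have [_ _ Vadd _ _] := sV.
set x := U tau q in Ax *.
have near_h : \forall h \near (0 : R)^'+, 0 <= t - (tau + h).
  near=> h; have : h < t - tau by near: h; apply: nbhs_right_lt; rewrite subr_gt0.
  lra.
have : V (t - (tau + h)) (iota h^-1 *: (U h x - x) - iota h^-1 *: (V h x - x))
    @[h --> 0^'+] --> V (t - tau) (A x - B x).
  apply: semigroup_cvg => //; first by rewrite subr_ge0 ltW.
    apply: cvg_at_right_filter; rewrite -[in X in _ --> X](addr0 tau).
    by apply: cvgB; [exact: cvg_cst|apply: cvgD; [exact: cvg_cst|exact: cvg_id]].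
  apply: (@continuous2_cvg _ E E E _ _ _ _ (fun a b => a - b)).
  - exact: (@sub_continuous E (A x, B x)).
  - exact: genA.
  - by apply: genB; rewrite -AB.
apply: cvg_trans; apply: near_eq_cvg; near=> h.
have h0 : 0 <= h by apply: ltW; near: h; exact: nbhs_right_gt.
have th : 0 <= t - (tau + h) by near: h.
rewrite -scalerBr semigroupZ//; congr (_ *: _).
have -> : U h x - x - (V h x - x) = U h x - V h x by rewrite opprB addrA subrK.
have -> : U (tau + h) q = U h x by rewrite addrC Uadd.
have -> : t - tau = t - (tau + h) + h by lra.
by rewrite semigroupB// (Vadd (t - (tau + h))) ?th.
Unshelve. all: by end_near. Qed.

(** Variation of constants: the derivative of the interpolation is integrated
    for [q] in the domain, and density extends the formula to [E]. *)
Lemma duhamel A B U V (D : {linear E -> E}) t q :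
  generated_semigroup iota A U -> generated_semigroup iota B V ->
  dom A = dom B -> dense (dom A) -> continuous D ->
  (forall x, dom A x -> A x = B x + D x) -> 0 <= t ->
  is_riemann_integral iota (fun tau => V (t - tau) (D (U tau q))) 0 t
    (U t q - V t q).
Proof.
move=> gU gV AB Adense Dcont AD t0.
have [[sU _] [sV _]] := (gU, gV).
have [[_ U0 _ _ Ueq] [_ V0 _ _ Veq]] := (sU, sV).
move: q; apply: (riemann_integral_dense HK (S := dom A)
  (T := fun tau q => V (t - tau) (D (U tau q))) (J := fun q => U t q - V t q)) => //.
- move=> x /andP[x0 xt] u v.
  by rewrite semigroupB// linearB semigroupB// subr_ge0.
- by move=> u v; rewrite !semigroupB// !opprD addrACA.
- move=> p /Veq[p1 sp1 Vp1].
  have [p2 sp2 Up2] : exists2 p2, seminorm p2 &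
      forall s x, 0 <= s -> p1 (D (U s x)) <= p2 x.
    suff /Ueq[p2 sp2 Up2] : seminorm (p1 \o D) by exists p2.
    have [p1ge0 p1D p1Z p1cont] := sp1; split=> [x|x y|z x|x] /=.
    + exact: p1ge0.
    + by rewrite linearD.
    + by rewrite linearZ p1Z.
    + by apply: continuous_comp; [exact: Dcont|exact: p1cont].
  exists p2 => // tau x /= /andP[tau0 taut].
  by rewrite (le_trans (Vp1 _ _ _))/= ?subr_ge0// Up2.
- move=> p sp; have [[p1 sp1 Up1] [p2 sp2 Vp2]] := (Ueq p sp, Veq p sp).
  have [[g1 D1 Z1 c1] [g2 D2 Z2 c2]] := (sp1, sp2).
  exists (p1 \+ p2) => [|_ x _].
    split=> [x|x y|z x|x] /=.
    + exact: addr_ge0.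
    + by rewrite addrACA lerD.
    + by rewrite !rmorphD Z1 Z2 mulrDr.
    + by apply: cvgD; [exact: c1|exact: c2].
  rewrite (le_trans (seminormD _ _ sp))// (seminormN HK)//.
  by apply: lerD; [exact: Up1|exact: Vp2].
move=> q Aq.
have -> : U t q - V t q = V (t - t) (U t q) - V (t - 0) (U 0 q).
  by rewrite subrr subr0 U0 V0.
apply: (right_derivative_riemann_integral HK
  (F := fun tau => V (t - tau) (U tau q))) => //.
- exact: (convolution_continuous sU sV Dcont).
- by apply: (convolution_continuous (C := id) sU sV) => x; exact: cvg_id.
move=> tau /andP[tau0 taut].
have Ax := generator_dom_invariant gU tau0 Aq.
have -> : D (U tau q) = A (U tau q) - B (U tau q).
  by rewrite AD// addrAC subrr add0r.
by apply: (interpolation_right_derivative gU gV AB Aq); rewrite tau0.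
Qed.

End Semigroups.

Unset Implicit Arguments.
Set Strict Implicit.

Theorem theorem1 (R : realType) (K : numFieldType) (iota : {rmorphism R -> K})
    (HK : real_or_complex iota)
    (E : tvsType K) (E_hausdorff : hausdorff_space E)
    (E_complete : sequentially_complete E)
    (A0 A1 : linear_operator E)
    (A0_dense : dense (dom A0)) (A1_dense : dense (dom A1))
    (A0_resolvent : exists (l0 : R) (R0 : E -> E), is_resolvent iota A0 l0 R0)
    (A1_resolvent : exists (l0 : R) (R1 : E -> E), is_resolvent iota A1 l0 R1)
    (A0_powers : equicontinuous_resolvent_powers iota A0)
    (A1_powers : equicontinuous_resolvent_powers iota A1)
    (Omega0 Omega1 : R -> E -> E)
    (A0_Omega0 : generated_semigroup iota A0 Omega0)
    (A1_Omega1 : generated_semigroup iota A1 Omega1)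
    (D : {linear E -> E}) (D_continuous : continuous D)
    (A01_dom : dom A1 = dom A0)
    (A01_D : forall q : E, dom A0 q -> A1 q = A0 q + D q)
    (t : R) (t_ge0 : 0 <= t) :
  (exists2 J : E -> E,
     is_strong_integral iota
       (fun tau => Omega0 (t - tau) \o D \o Omega1 tau) 0 t J &
     Omega1 t = Omega0 t \+ J) /\
  (exists2 J : E -> E,
     is_strong_integral iota
       (fun tau => Omega1 (t - tau) \o D \o Omega0 tau) 0 t J &
     Omega1 t = Omega0 t \+ J).
Proof.
have [[s0 _] [s1 _]] := (A0_Omega0, A1_Omega1).
have integral1 q : is_riemann_integral iota
    (fun tau => Omega0 (t - tau) (D (Omega1 tau q))) 0 t (Omega1 t q - Omega0 t q).
  apply: (duhamel HK A1_Omega1 A0_Omega0 A01_dom A1_dense D_continuous) => //.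
  by move=> x; rewrite A01_dom; exact: A01_D.
have integral2 q : is_riemann_integral iota
    (fun tau => Omega1 (t - tau) (D (Omega0 tau q))) 0 t (Omega1 t q - Omega0 t q).
  pose D' : {linear E -> E} := \- D.
  have D'_continuous : continuous D'.
    by move=> x; apply: continuous_comp; [exact: D_continuous|exact: opp_continuous].
  rewrite -opprB; apply: (riemann_integral_opp
    (f := fun tau => Omega1 (t - tau) (D' (Omega0 tau q)))).
    move=> tau /andP[tau0 taut].
    by rewrite /= -[- D _]scaleN1r (semigroupZ _ _ s1) ?subr_ge0// scaleN1r opprK.
  apply: (duhamel HK A0_Omega0 A1_Omega1 _ A0_dense D'_continuous) => // x Ax.
  by rewrite A01_D//= addrK.
split; exists (fun q => Omega1 t q - Omega0 t q).
- move=> q; split; last exact: integral1.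
  exact: (convolution_continuous HK s1 s0 D_continuous).
- by apply/funext => q /=; rewrite addrC subrK.
- move=> q; split; last exact: integral2.
  exact: (convolution_continuous HK s0 s1 D_continuous).
- by apply/funext => q /=; rewrite addrC subrK.
Qed.
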